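(* Let $\sigma=(\sigma_i)_{i\ge0}\in\{0,1\}^{\mathbb N_0}$ and $h_n=2^{\sum_{i=0}^{n-1}\sigma_i}$, $n\ge1$. Then $(h_n)$ is a scaling sequence of the dyadic filtration $\zeta=(\zeta_n)_{n\ge0}$ on $(I^{\mathcal D}\times I^{\mathbb N},\omega^\sigma)$, and also of the tail filtration $\xi=(\xi_n)_{n\ge0}$ on $(\mathcal T(\mathrm{OP}),\mu^\sigma)$, which is isomorphic to $\zeta$.
   Context: $I=\{0,1\}$; $\mathcal D=\bigoplus_{i\ge0}\mathbb Z/2\mathbb Z$ with generators $g_0,g_1,\dots$, $\mathcal D_n=\langle g_0,\dots,g_{n-1}\rangle$. $I^{\mathbb N}$ is the group of $0$–$1$ sequences $(\alpha_i)_{i\ge1}$ (addition mod 2) with uniform Bernoulli measure $m$; $\tau(\sum_i\alpha_ig_{i-1})=(\alpha_i)_{i\ge1}$. $\operatorname{diag}(g)(w,\alpha)=(w(\cdot+g),\alpha+\tau(g))$ is a free action on $I^{\mathcal D}\times I^{\mathbb N}$; $\zeta_n$ is the partition into $\operatorname{diag}(\mathcal D_n)$-orbits. Let $\mathcal D^\sigma=\langle g_i:\sigma_i=0\rangle$; $m^\sigma$ is the law on $I^{\mathcal D}$ of a random configuration constant on cosets of $\mathcal D^\sigma$ with independent uniform values on distinct cosets; $\omega^\sigma=m^\sigma\times m$. The graph $\mathrm{OP}$: $\mathrm{OP}_0=I$, $\mathrm{OP}_{n+1}=\mathrm{OP}_n\times\mathrm{OP}_n$, with an index-0 edge from $v_0$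 and an index-1 edge from $v_1$ to each $v=(v_0,v_1)$; $\mathcal T(\mathrm{OP})$ is its space of infinite paths from floor 0; $\xi_n$ is the partition into classes of paths coinciding from floor $n$ on. There is a homeomorphism $\Psi\colon\mathcal T(\mathrm{OP})\to I^{\mathcal D}\times I^{\mathbb N}$ mapping $\xi_n$ to $\zeta_n$ for all $n$ (explicitly: $\Psi[x]=(F[x],\alpha)$ where $\alpha_n$ is the index of the $(n-1)$-th edge of $x$ and $F[x](g)=\Phi[v_n](g+\sum_{i<n}\alpha_{i+1}g_i)$ for $g\in\mathcal D_n$, with $\Phi$ labelling floor-$n$ vertices by configurations on $\mathcal D_n$ recursively via $\Phi[(v_0,v_1)](h)=\Phi[v_0](h)$ on $\mathcal D_n$, $=\Phi[v_1](g_n+h)$ on $\mathcal D_{n+1}\setminus\mathcal D_n$); $\mu^\sigma=\Psi^{-1}_*\omega^\sigma$. A dyadic filtration is a sequence of measurable partitions $\varsigma_0\succ\varsigma_1\succ\dots$ with $\varsigma_0$ the partition into points and each element of $\varsigma_{n+1}$ the union of two elements of $\varsigma_n$. Kantorovich iteration: $\mathcal K_n[\rho](c_1,c_2)=\min_s 2^{-n}\sum_{x\in c_1}\rho(x,s(x))$ for $c_1,c_2\in\varsigma_n$, over bijections $s\colon c_1\to c_2$ mapping, for each $j<n$, elements of $\varsigma_j$ in $c_1$ onto elements of $\varsigma_j$ in $c_2$. $\mathbb H_\varepsilon(Y,\nu,d)$ is the binary logarithm of the least $k$ with a measurable partition $Y_0,\dots,Y_k$, $\nu(Y_0)<\varepsilon$,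 $\operatorname{diam}_dY_j<\varepsilon$ ($j\ge1$). A positive sequence $h$ is a scaling sequence of the filtration $\varsigma$ on $(X,\mu)$ if for some (equivalently every) summable admissible metric $\rho$ (measurable on $X^2$, in $L^1(\mu^2)$, a separable metric on a set of full measure) and all sufficiently small $\varepsilon>0$, $\mathbb H_\varepsilon(X/\varsigma_n,\mu/\varsigma_n,\mathcal K_n[\rho])\asymp h_n$, where $a_n\asymp b_n$ means $0<\liminf a_n/b_n\le\limsup a_n/b_n<\infty$. *)

(* Defs.v *)
From HB Require Import structures.
From mathcomp Require Import all_boot all_order all_algebra.
From mathcomp Require Import all_classical all_reals all_analysis.
Set Implicit Arguments. Unset Strict Implicit. Unset Printing Implicit Defensive.
Import Order.TTheory GRing.Theory Num.Theory.
Local Open Scope classical_set_scope.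
Local Open Scope ring_scope.

(* A filtration is given as a family of equivalence relations S n :    *)
(* S n x is the element of varsigma_n containing x.                   *)

Section Generic.
Context {d : measure_display} {T : measurableType d} {R : realType}.

Definition Kant (S : nat -> T -> T -> Prop) (rho : T -> T -> R) (n : nat)
    (x y : T) : \bar R :=
  ereal_inf [set ((2%:R ^+ n)^-1 * \sum_(z \in S n x) rho z (s z))%:E
            | s in [set s : T -> T | set_bij (S n x) (S n y) s /\
                (forall j, (j < n)%N -> forall z, S n x z ->
                   s @` (S j z) = S j (s z))]].

Definition Kdiam (S : nat -> T -> T -> Prop) (rho : T -> T -> R) (n : nat)
    (Y : set T) : \bar R :=
  ereal_sup [set r | exists x y, Y x /\ Y y /\ r = Kant S rho n x y].

(* k such that there is a measurable partition Y_0, ..., Y_k of X/varsigma_n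
   (i.e. of X into varsigma_n-saturated measurable sets) with
   mu(Y_0) < eps and diam Y_j < eps for 1 <= j <= k *)
Definition eps_partition (mu : set T -> \bar R) (S : nat -> T -> T -> Prop)
    (rho : T -> T -> R) (eps : R) (n k : nat) : Prop :=
  exists Y : nat -> set T,
    (forall j, (j <= k)%N -> measurable (Y j) /\
        (forall x y, S n x y -> Y j x -> Y j y)) /\
    (forall i j, (i <= k)%N -> (j <= k)%N -> i <> j -> Y i `&` Y j = set0) /\
    \bigcup_(j in [set j | (j <= k)%N]) Y j = setT /\
    (mu (Y 0%N) < eps%:E)%E /\
    (forall j, (1 <= j <= k)%N -> (Kdiam S rho n (Y j) < eps%:E)%E).

(* H_eps(X/varsigma_n, mu/varsigma_n, K_n[rho]) = log_2 (least such k);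
   +oo if there is no such k *)
Definition entropy (mu : set T -> \bar R) (S : nat -> T -> T -> Prop)
    (rho : T -> T -> R) (eps : R) (n : nat) : \bar R :=
  match ereal_inf [set (k%:R)%:E | k in [set k | eps_partition mu S rho eps n k]]
  with
  | EFin r => (ln r / ln 2)%:E
  | _ => +oo%E
  end.

Definition asymp (a : nat -> \bar R) (b : nat -> R) : Prop :=
  (0 < limn_einf (fun n => a n * (b n)^-1%:E))%E /\
  (limn_esup (fun n => a n * (b n)^-1%:E) < +oo)%E.

Definition admissible (mu : probability T R) (rho : T -> T -> R) : Prop :=
  measurable_fun setT (fun z : T * T => rho z.1 z.2) /\
  (mu \x mu)%E.-integrable setT (fun z : T * T => (rho z.1 z.2)%:E) /\
  exists A : set T, measurable A /\ mu (~` A) = 0%E /\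
    (forall x y, A x -> A y -> (rho x y = 0 <-> x = y)) /\
    (forall x y, A x -> A y -> rho x y = rho y x) /\
    (forall x y z, A x -> A y -> A z -> rho x z <= rho x y + rho y z) /\
    (exists D : set T, D `<=` A /\ countable D /\
       forall x, A x -> forall e, 0 < e -> exists2 t, D t & rho x t < e).

Definition scaling_sequence (mu : probability T R) (S : nat -> T -> T -> Prop)
    (h : nat -> R) : Prop :=
  exists rho, admissible mu rho /\
  exists eps0 : R, 0 < eps0 /\
    forall eps, 0 < eps < eps0 -> asymp (fun n => entropy mu S rho eps n) h.

End Generic.

(* The space I^D x I^N.  D = (+)_{i>=0} Z/2 is encoded as nat with     *)
(* bitwise xor: g_i = 2^i, D_n = {g | g < 2^n}.  The sequence          *)
(* (alpha_i)_{i>=1} is encoded as a : nat -> bool with a i = alpha_{i+1}. *)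

Definition Xbase := ((nat -> bool) * (nat -> bool))%type.

Definition GX : set (set Xbase) :=
  [set A | (exists k b, A = [set x | x.1 k = b]) \/
           (exists i b, A = [set x | x.2 i = b])].

Definition Xm := g_sigma_algebraType GX.

Definition diag (g : nat) (x : Xm) : Xm :=
  (fun k => x.1 (Nat.lxor k g), fun i => xorb (x.2 i) (Nat.testbit g i)).

Definition zeta (n : nat) (x y : Xm) : Prop :=
  exists g, (g < 2 ^ n)%N /\ y = diag g x.

(* k and k' lie in the same coset of D^sigma = <g_i : sigma_i = 0> *)
Definition same_coset (sigma : nat -> bool) (k k' : nat) : Prop :=
  forall i, Nat.testbit (Nat.lxor k k') i = true -> sigma i = false.

(* a key identifying the coset of k mod D^sigma (the bits of k at
   positions i with sigma_i = 1; k has no bits beyond position k) *)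
Definition coset_key (sigma : nat -> bool) (k : nat) : seq nat :=
  [seq i <- iota 0 k.+1 | Nat.testbit k i && sigma i].

(* omega^sigma = m^sigma x m, characterized on cylinder sets *)
Definition omega_sigma (R : realType) (sigma : nat -> bool)
    (P : probability Xm R) : Prop :=
  forall (K J : seq nat) (f g : nat -> bool),
    P [set x : Xm | (forall k, k \in K -> x.1 k = f k) /\
                    (forall j, j \in J -> x.2 j = g j)] =
    if `[< forall k k', k \in K -> k' \in K -> same_coset sigma k k' ->
                        f k = f k' >]
    then ((2%:R ^+ (size (undup (map (coset_key sigma) K)) + size (undup J)))^-1)%:E
    else 0%E.

Fixpoint OP (n : nat) : Type :=
  match n with 0 => bool | m.+1 => (OP m * OP m)%type end.

(* An infinite path: vertices tv n on floor n, and te n = index of the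
   n-th edge (from floor n to floor n+1): tv n is component (te n) of
   tv (n+1). *)
Record TOP := mkTOP {
  tv : forall n, OP n;
  te : nat -> bool;
  tpath : forall n, tv n = if te n then (tv n.+1).2 else (tv n.+1).1 }.

Fixpoint OPfalse (n : nat) : OP n :=
  match n return OP n with 0 => false | m.+1 => (OPfalse m, OPfalse m) end.

Definition TOPpoint : TOP := @mkTOP OPfalse (fun _ => false) (fun _ => erefl).

HB.instance Definition _ := gen_eqMixin TOP.
HB.instance Definition _ : hasChoice TOP := gen_choiceMixin TOP.
HB.instance Definition _ := isPointed.Build TOP TOPpoint.

Definition GT : set (set TOP) :=
  [set A | (exists n (v : OP n), A = [set x | tv x n = v]) \/
           (exists n b, A = [set x | te x n = b])].

Definition Tm := g_sigma_algebraType GT.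

Definition xi (n : nat) (x y : Tm) : Prop :=
  (forall m, (n <= m)%N -> tv x m = tv y m) /\
  (forall m, (n <= m)%N -> te x m = te y m).

(* Phi : labelling of floor-n vertices by configurations on D_n *)
Fixpoint Phi (n : nat) : OP n -> nat -> bool :=
  match n return OP n -> nat -> bool with
  | 0 => fun v _ => v
  | m.+1 => fun v h => if (h < 2 ^ m)%N then @Phi m v.1 h
                       else @Phi m v.2 (Nat.lxor (2 ^ m) h)
  end.

Definition tshift (x : TOP) (n : nat) : nat := (\sum_(i < n) te x i * 2 ^ i)%N.

(* Psi[x] = (F[x], alpha); F[x](g) is computed on floor n = g (g \in D_g) *)
Definition Psi (x : Tm) : Xm :=
  (fun g => Phi (tv x g) (Nat.lxor g (tshift x g)), te x).

(* Main.v *)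
Require Import Defs.
From Stdlib Require Import PeanoNat.
From mathcomp Require Import all_boot all_order all_algebra.
From mathcomp Require Import all_classical all_reals all_analysis.
From mathcomp Require Import measurable_realfun.
From mathcomp Require Import zify ring lra.
Import Order.TTheory GRing.Theory Num.Theory.
Set Implicit Arguments. Unset Strict Implicit. Unset Printing Implicit Defensive.

(* The metric is the ultrametric [rho] with [rho x y = 2 ^ -N] for the least [N] at which the
   coordinates of [x] and [y] of index below [N] (configuration on [D_N], first [N] terms of
   [alpha]) differ.

   Lower bound. A bijection of [zeta_n]-classes compatible with the finer classes is an isomorphism
   of binary trees, and [rho] is [1] where the values at [0] differ; hence [K_n] dominates the
   normalized Hamming distance of configurations on [D_n] minimised over tree automorphisms. With
   [m] ones among [sigma_0, ..., sigma_(n-1)], almost every configuration on [D_n] is one of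
   [2 ^ 2 ^ m] configurations, each of probability [2 ^ - 2 ^ m], indexed by the labelled binary
   trees of depth [m], and the distance is the one between these trees. The sums
   [G u = \sum_v t ^ dist u v] satisfy [G (u1, u2) <= 2 * G u1 * G u2]; starting at depth 2 with
   [t = (2 / 3) ^ 8], this bounds the number of trees in a ball of radius [1 / 32] by
   [13 ^ 2 ^ (m - 2) / 2], which is exponentially smaller in [2 ^ m] than [16 ^ 2 ^ (m - 2)].

   Upper bound. Each [zeta_n]-class has a unique point with [alpha_1 = ... = alpha_n = 0]. If these
   points of two classes carry the same configuration on [D_n], the equivariant bijection between
   the classes shows that their distance is at most [2 ^ -n]; so [2 ^ 2 ^ m] sets suffice. *)

(** * Bits and labelled binary trees *)

Local Notation "a (^) b" := (Nat.lxor a b) (at level 50, left associativity).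

Lemma expn2E n : 2 ^ n = Nat.pow 2 n.
Proof. by elim: n => // n IH; rewrite expnS IH. Qed.

(** Turns membership in [D_n], encoded as [g < 2 ^ n], into a condition on bits, on which xor acts
    pointwise. *)
Lemma ltn_exp2P g n :
  reflect (forall i, n <= i -> Nat.testbit g i = false) (g < 2 ^ n).
Proof.
have nz : Nat.pow 2 n <> 0 by apply: Nat.pow_nonzero.
have modE : (g < 2 ^ n) = (g == Nat.modulo g (Nat.pow 2 n)).
  apply/idP/eqP => [/ssrnat.ltP|->]; rewrite expn2E.
    by move/Nat.mod_small.
  by apply/ssrnat.ltP; apply: Nat.mod_upper_bound.
rewrite modE; apply: (iffP eqP) => [-> i /ssrnat.leP|high].
  exact: Nat.mod_pow2_bits_high.
apply: Nat.bits_inj => i; case: (ltnP i n) => [/ssrnat.ltP|/[dup] /ssrnat.leP] lein.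
  by rewrite Nat.mod_pow2_bits_low.
by move=> /high ->; rewrite Nat.mod_pow2_bits_high.
Qed.

Lemma testbit_exp2 n i : Nat.testbit (2 ^ n) i = (n == i).
Proof.
rewrite expn2E Nat.pow2_bits_eqb.
by case: (eqVneq n i) => [->|/eqP neq]; [rewrite Nat.eqb_refl | apply/Nat.eqb_neq].
Qed.

Lemma testbit_small g n i : g < 2 ^ n -> n <= i -> Nat.testbit g i = false.
Proof. by move/ltn_exp2P; apply. Qed.

Lemma lxor_lt n a b : a < 2 ^ n -> b < 2 ^ n -> a (^) b < 2 ^ n.
Proof.
move=> an bn; apply/ltn_exp2P => i le; rewrite Nat.lxor_spec.
by rewrite !(@testbit_small _ n).
Qed.

Lemma addn_lxor n a : a < 2 ^ n -> 2 ^ n + a = a (^) 2 ^ n.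
Proof.
move=> an; rewrite addnC; apply: Nat.add_nocarry_lxor; apply: Nat.bits_inj => i.
rewrite Nat.land_spec testbit_exp2 Nat.bits_0.
by case: eqP => [<-|]; rewrite ?andbF // (testbit_small an).
Qed.

(** [D_(n+1)] consists of [D_n] and its translate by [g_n]; the inductions over trees split along
    these halves. *)
Lemma ltn_exp2SP g n : g < 2 ^ n.+1 ->
  g < 2 ^ n \/ exists2 g', g' < 2 ^ n & g = g' (^) 2 ^ n.
Proof.
move=> ltg; case: (ltnP g (2 ^ n)) => [|le]; [by left | right].
have lt' : g - 2 ^ n < 2 ^ n by move: ltg; rewrite expnS; lia.
by exists (g - 2 ^ n) => //; rewrite -addn_lxor // subnKC.
Qed.

Lemma lxorA : associative Nat.lxor.
Proof. by move=> a b c; rewrite Nat.lxor_assoc. Qed.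

Lemma lxorC : commutative Nat.lxor.
Proof. exact: Nat.lxor_comm. Qed.

Lemma lxorAC : right_commutative Nat.lxor.
Proof. by move=> a b c; rewrite -lxorA (lxorC b) lxorA. Qed.

Lemma lxorK a b : a (^) b (^) b = a.
Proof. by rewrite -lxorA Nat.lxor_nilpotent Nat.lxor_0_r. Qed.

Lemma exp2_ltS n : 2 ^ n < 2 ^ n.+1.
Proof. by rewrite ltn_exp2l. Qed.

Lemma ltn_exp2S g n : g < 2 ^ n -> g < 2 ^ n.+1.
Proof. by move/ltn_trans; apply; apply: exp2_ltS. Qed.

(** The element of [D_n] that [tau] sends to the first [n] terms of [a], followed by zeros. *)
Fixpoint prefix_nat (a : nat -> bool) (n : nat) : nat :=
  match n with
  | 0 => 0
  | k.+1 => prefix_nat a k (^) (if a k then 2 ^ k else 0)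
  end.

Lemma testbit_prefix_nat a n i : Nat.testbit (prefix_nat a n) i = (i < n) && a i.
Proof.
elim: n => [|n IH] /=; first by rewrite Nat.bits_0.
rewrite Nat.lxor_spec IH ltnS (leq_eqVlt i) eq_sym.
have -> : Nat.testbit (if a n then 2 ^ n else 0) i = a n && (n == i).
  by case: (a n); rewrite ?testbit_exp2 // Nat.bits_0.
case: eqP => [<-|_] /=; first by rewrite ltnn andbT.
by rewrite andbF Bool.xorb_false_r.
Qed.

Lemma prefix_nat_lt a n : prefix_nat a n < 2 ^ n.
Proof. by apply/ltn_exp2P => i le; rewrite testbit_prefix_nat ltnNge le. Qed.

Lemma prefix_nat_lxor a b n g : g < 2 ^ n ->
  (forall i, b i = xorb (a i) (Nat.testbit g i)) ->
  prefix_nat b n = prefix_nat a n (^) g.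
Proof.
move=> ltg ab; apply: Nat.bits_inj => i.
rewrite Nat.lxor_spec !testbit_prefix_nat ab.
by case: ltnP => //= le; rewrite (testbit_small ltg).
Qed.

(** * Labelled binary trees up to automorphism *)

Fixpoint btree (n : nat) : finType :=
  match n with 0 => bool | m.+1 => (btree m * btree m)%type end.

Lemma card_btree n : #|btree n| = 2 ^ 2 ^ n.
Proof. by elim: n => [|n IH]; rewrite ?card_bool //= card_prod IH -expnD addnn -mul2n expnS. Qed.

Fixpoint config_tree (n : nat) (w : nat -> bool) : btree n :=
  match n with
  | 0 => w 0
  | m.+1 => (config_tree m w, config_tree m (fun k => w (k (^) 2 ^ m)))
  end.

Lemma config_tree_eqP n w w' :
  config_tree n w = config_tree n w' <-> forall k, k < 2 ^ n -> w k = w' k.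
Proof.
elim: n w w' => [|n IH] w w' /=.
  split=> [e [|k]//|]; exact.
split=> [[/IH e1 /IH e2] k /ltn_exp2SP[/e1//|[h lth ->]]|e].
  exact: e2.
congr (_, _); apply/IH => k ltk; apply: e; first exact: ltn_exp2S.
by apply: lxor_lt; [exact: ltn_exp2S | exact: exp2_ltS].
Qed.

(* The Hamming distance minimised over the automorphisms of the binary tree. *)
Fixpoint tdist (n : nat) : btree n -> btree n -> nat :=
  match n return btree n -> btree n -> nat with
  | 0 => fun u v => u != v
  | m.+1 => fun u v => minn (tdist u.1 v.1 + tdist u.2 v.2)
                            (tdist u.1 v.2 + tdist u.2 v.1)
  end.

(** Translation by [g] is a tree automorphism: the top bit exchanges the two halves, under which the
    minimum is symmetric, and the lower bits act inside the halves. *)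
Lemma tdist_shift n g u w : g < 2 ^ n ->
  tdist u (config_tree n (fun k => w (k (^) g))) = tdist u (config_tree n w).
Proof.
elim: n g u w => [|n IH] g u w.
  by rewrite expn0 ltnS leqn0 => /eqP->.
move=> /ltn_exp2SP[ltg|[h ltg ->]] /=.
  rewrite !(IH g _ w) //.
  have E v : tdist v (config_tree n (fun k => w (k (^) 2 ^ n (^) g))) =
            tdist v (config_tree n (fun k => w (k (^) 2 ^ n))).
    rewrite -(IH g _ (fun k => w (k (^) 2 ^ n))) //.
    by congr tdist; apply/config_tree_eqP => k _; rewrite lxorAC.
  by rewrite !E.
have E1 v : tdist v (config_tree n (fun k => w (k (^) (h (^) 2 ^ n)))) =
            tdist v (config_tree n (fun k => w (k (^) 2 ^ n))).
  rewrite -(IH h _ (fun k => w (k (^) 2 ^ n))) //.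
  by congr tdist; apply/config_tree_eqP => k _; rewrite lxorA.
have E2 v : tdist v (config_tree n (fun k => w (k (^) 2 ^ n (^) (h (^) 2 ^ n)))) =
            tdist v (config_tree n w).
  rewrite -(IH h _ w) //.
  by congr tdist; apply/config_tree_eqP => k _; rewrite lxorA lxorAC lxorK.
by rewrite !E1 !E2 minnC.
Qed.

(** * Configurations constant on the cosets of [D^sigma] *)

Section Expand.
Variable sigma : nat -> bool.

Fixpoint nones (n : nat) : nat :=
  match n with
  | 0 => 0
  | k.+1 => if sigma k then (nones k).+1 else nones k
  end.

Lemma nonesE n : \sum_(i < n) sigma i = nones n.
Proof.
elim: n => [|n IH]; first by rewrite big_ord0.
by rewrite big_ord_recr /= IH; case: (sigma n); rewrite ?addn1 ?addn0.
Qed.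

(* Parametrizes the configurations on [D_n] that are constant on the cosets of [D^sigma]. *)
Fixpoint tree_expand (n : nat) : btree (nones n) -> btree n :=
  match n return btree (nones n) -> btree n with
  | 0 => id
  | k.+1 => match sigma k as b
              return btree (if b then (nones k).+1 else nones k) -> btree k.+1 with
            | true => fun u => (tree_expand u.1, tree_expand u.2)
            | false => fun u => (tree_expand u, tree_expand u)
            end
  end.

(** Where [sigma] is [0] both halves are equal, so the two matchings cost the same and the distance
    doubles; where it is [1] the recursions coincide. Distances divided by the number of leaves
    therefore agree. *)
Lemma tdist_tree_expand n u v :
  2 ^ nones n * tdist (@tree_expand n u) (tree_expand v) = 2 ^ n * tdist u v.
Proof.
elim: n u v => // n IH /=.
case: (sigma n) => u v /=.
  by rewrite !expnS -!mulnA; congr (2 * _); rewrite !minnMr !mulnDr !IH.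
by rewrite minnn addnn -mul2n mulnCA IH expnS mulnA.
Qed.

Definition invariant_config (w : nat -> bool) :=
  forall i k, sigma i = false -> w (k (^) 2 ^ i) = w k.

Lemma invariant_configS w g :
  invariant_config w -> invariant_config (fun k => w (k (^) g)).
Proof. by move=> inv i k si; rewrite lxorAC inv. Qed.

Lemma invariant_tree_expand n w : invariant_config w ->
  exists u, config_tree n w = tree_expand u.
Proof.
elim: n w => [|n IH] w inv /=; first by exists (w 0).
have [u eu] := IH _ inv.
have [v ev] := IH _ (invariant_configS (2 ^ n) inv).
have same : sigma n = false -> config_tree n (fun k => w (k (^) 2 ^ n)) = config_tree n w.
  by move=> s0; apply/config_tree_eqP => k _; apply: inv.
move: same; case: (sigma n) => same; first by exists (u, v); rewrite eu ev.
by exists u; rewrite same // eu.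
Qed.

(** Represents each coset of [D^sigma] meeting [D_n] by its element with bits only where [sigma] is
    [1]. *)
Fixpoint transversal_nat (n : nat) : seq nat :=
  match n with
  | 0 => [:: 0]
  | k.+1 => if sigma k then transversal_nat k ++ [seq j (^) 2 ^ k | j <- transversal_nat k]
            else transversal_nat k
  end.

Lemma size_transversal_nat n : size (transversal_nat n) = 2 ^ nones n.
Proof.
by elim: n => //= n IH; case: (sigma n); rewrite // size_cat size_map IH expnS mul2n addnn.
Qed.

Lemma transversal_natP n k : k \in transversal_nat n ->
  k < 2 ^ n /\ forall i, Nat.testbit k i -> sigma i.
Proof.
elim: n k => [|n IH] k /=.
  by rewrite inE => /eqP->; split=> // i; rewrite Nat.bits_0.
case sn : (sigma n); last by move=> /IH[/ltn_exp2S].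
rewrite mem_cat => /orP[/IH[/ltn_exp2S]//|/mapP[j /IH[ltj bj] ->]].
split=> [|i]; first by apply: lxor_lt; [exact: ltn_exp2S | exact: exp2_ltS].
rewrite Nat.lxor_spec testbit_exp2; case: eqP => [<-//|_].
by case E: (Nat.testbit j i) => // _; apply: bj.
Qed.

Lemma transversal_nat_uniq n : uniq (transversal_nat n).
Proof.
elim: n => //= n IH; case: (sigma n) => //.
rewrite cat_uniq IH map_inj_uniq ?IH ?andbT; last first.
  by move=> a b e; rewrite -(lxorK a (2 ^ n)) e lxorK.
apply/hasPn => _ /mapP[j jT ->]; apply/negP => /transversal_natP[+ _].
have [ltj _] := transversal_natP jT.
by rewrite -addn_lxor // ltnNge leq_addr.
Qed.

Lemma testbit_leq k i : Nat.testbit k i -> i <= k.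
Proof.
move=> ki; rewrite leqNgt; apply/negP => ltki.
move: ki; rewrite (@testbit_small k i) //.
exact: (ltn_trans ltki (ltn_expl _ _)).
Qed.

Lemma mem_coset_key k i :
  (i \in coset_key sigma k) = Nat.testbit k i && sigma i.
Proof.
rewrite mem_filter mem_iota /= add0n ltnS.
by case E: (Nat.testbit k i) => //=; rewrite (testbit_leq E) andbT.
Qed.

(** A representative has no bits besides those listed in its key, so the key determines it. *)
Lemma coset_key_transversal_uniq n :
  uniq [seq coset_key sigma k | k <- transversal_nat n].
Proof.
rewrite map_inj_in_uniq ?transversal_nat_uniq //.
move=> a b /transversal_natP[_ ba] /transversal_natP[_ bb] e.
apply: Nat.bits_inj => i.
have := mem_coset_key a i; rewrite e mem_coset_key.
case Ea: (Nat.testbit a i); case Eb: (Nat.testbit b i) => //=.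
  by rewrite (ba _ Ea).
by rewrite (bb _ Eb).
Qed.

Lemma same_coset_exp2 i k :
  sigma i = false -> same_coset sigma k (k (^) 2 ^ i).
Proof.
by move=> s0 j; rewrite lxorA Nat.lxor_nilpotent Nat.lxor_0_l testbit_exp2 => /eqP<-.
Qed.

End Expand.

(** * Counting trees in small balls *)

Local Open Scope ring_scope.

(** A power of [t] at a minimum is at most the sum of the powers at both arguments, and for each of
    the two matchings the sum over [v] factorises. *)
Lemma sum_tdist_btreeS (R : realFieldType) (t : R) n (u : btree n.+1) : 0 <= t ->
  \sum_(v : btree n.+1) t ^+ tdist u v <=
  2 * (\sum_v t ^+ tdist u.1 v) * (\sum_v t ^+ tdist u.2 v).
Proof.
move=> t0.
have -> : 2 * (\sum_v t ^+ tdist u.1 v) * (\sum_v t ^+ tdist u.2 v) =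
  \sum_(v : btree n.+1) (t ^+ tdist u.1 v.1 * t ^+ tdist u.2 v.2
                         + t ^+ tdist u.1 v.2 * t ^+ tdist u.2 v.1).
  pose A v := t ^+ tdist u.1 v; pose B v := t ^+ tdist u.2 v.
  have -> : \sum_(v : btree n.+1) (A v.1 * B v.2 + A v.2 * B v.1) =
            \sum_v1 \sum_v2 (A v1 * B v2 + A v2 * B v1).
    by rewrite pair_bigA.
  have -> : \sum_v1 \sum_v2 (A v1 * B v2 + A v2 * B v1) =
            \sum_v1 \sum_v2 A v1 * B v2 + \sum_v1 \sum_v2 A v2 * B v1.
    by rewrite -big_split; apply: eq_bigr => v1 _; rewrite -big_split.
  rewrite [X in _ = _ + X]exchange_big /= -mulrA mulr_natl mulr2n.
  by rewrite big_distrlr.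
apply: ler_sum => v _ /=; rewrite -!exprD.
by case: leqP => _; rewrite ?lerDl ?lerDr exprn_ge0.
Qed.

(** At most 4 of the 16 trees are at distance [0] from [u], hence a bound near 4. Depth 2 is the
    first at which twice the sum stays below the number of trees: at depths 0 and 1 it can reach 2
    and 4, which is all of them. *)
Lemma sum_tdist_btree2 (R : realFieldType) (t : R) (u : btree 2) :
  0 <= t <= 1 / 25 -> \sum_(v : btree 2) t ^+ tdist u v <= 13 / 3.
Proof.
move=> /andP[t0 t1].
(* These bounds make each of the sixteen cases of [u] linear in the powers of [t]. *)
have t2 : t ^+ 2 <= t / 25 by rewrite expr2; nra.
have t20 : 0 <= t ^+ 2 by apply: exprn_ge0.
have t3 : t ^+ 3 <= t / 25 by rewrite exprS; nra.
have t4 : t ^+ 4 <= t / 25 by rewrite exprS exprS; nra.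
have -> : \sum_(v : btree 2) t ^+ tdist u v =
    \sum_(a : bool) \sum_(b : bool) \sum_(c : bool) \sum_(e : bool)
       t ^+ @tdist 2 u ((a, b), (c, e)).
  rewrite -(pair_bigA _ (fun v1 v2 => t ^+ @tdist 2 u (v1, v2))).
  rewrite -(pair_bigA _ (fun a b => \sum_(v2 : btree 1) t ^+ @tdist 2 u ((a, b), v2))).
  apply: eq_bigr => a _; apply: eq_bigr => b _.
  by rewrite -(pair_bigA _ (fun c e => t ^+ @tdist 2 u ((a, b), (c, e)))).
case: u => [[[] []] [[] []]]; rewrite !big_bool /= /minn /=;
  rewrite ?addn0 ?add0n ?expr0 ?expr1; lra.
Qed.

(** With the factor 2 the recursive inequality becomes multiplicative, so the bound [26 / 3] at
    depth 2 is squared at each further level. *)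
Lemma sum_tdist_btree (R : realFieldType) (t : R) p (u : btree p.+2) :
  0 <= t <= 1 / 25 -> 2 * \sum_v t ^+ tdist u v <= (26 / 3) ^+ (2 ^ p).
Proof.
move=> t01; have [t0 _] := andP t01.
elim: p u => [|p IH] u.
  by rewrite expn0 expr1; have := sum_tdist_btree2 u t01; lra.
have sum0 v : 0 <= \sum_(z : btree p.+2) t ^+ tdist v z.
  by apply: sumr_ge0 => z _; rewrite exprn_ge0.
have := sum_tdist_btreeS u t0.
have sum20 v : 0 <= 2 * \sum_(z : btree p.+2) t ^+ tdist v z by rewrite mulr_ge0.
have := ler_pM (sum20 u.1) (sum20 u.2) (IH u.1) (IH u.2).
rewrite -exprD addnn -mul2n -expnS.
set a := \sum_v t ^+ @tdist p.+2 u.1 v; set b := \sum_v t ^+ @tdist p.+2 u.2 v.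
set c := \sum_v _ => H1 H2; move: H1; rewrite -mulrA [a * _]mulrCA => H1.
by apply: le_trans H1; rewrite ler_pM2l // mulrA.
Qed.

Definition tball m (u : btree m) : {set btree m} :=
  [set v | (32 * tdist u v < 2 ^ m)%N].

(* Chernoff bound: [t ^ tdist] is at least [(2 / 3) ^ (2 ^ p)] on the ball for [t = (2 / 3) ^ 8]. *)
Lemma card_tball (R : realFieldType) p (u : btree p.+2) :
  2 * #|tball u|%:R <= 13 ^+ (2 ^ p) :> R.
Proof.
pose t : R := (2 / 3) ^+ 8.
have t01 : 0 <= t <= 1 / 25 by rewrite /t; apply/andP; split; lra.
have t0 : 0 <= t by have [] := andP t01.
have lbt : (2 / 3) ^+ (2 ^ p) * #|tball u|%:R <= \sum_v t ^+ tdist u v.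
  rewrite mulr_natr -sumr_const [leRHS](bigID (mem (tball u))) -[leLHS]addr0.
  apply: lerD; last by apply: sumr_ge0 => v _; rewrite exprn_ge0.
  (* In the ball [32 * tdist u v < 4 * 2 ^ p], that is [8 * tdist u v < 2 ^ p]; this is why [t] has
     exponent 8. *)
  apply: ler_sum => v; rewrite inE !expnS /t -exprM.
  move: (tdist u v) (2 ^ p)%N => a b lt.
  by apply: ler_wiXn2l; [lra | lra | lia].
have := sum_tdist_btree u t01.
have -> : (26 / 3 : R) = (2 / 3) * 13 by lra.
rewrite exprMn => ub.
have pos : 0 < (2 / 3 : R) ^+ (2 ^ p) by rewrite exprn_gt0 //; lra.
rewrite -(ler_pM2l pos); lra.
Qed.

(** With at most two leaves the ball contains only trees at distance [0], at most half of all
    trees. *)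
Lemma card_tball_small m (u : btree m) : (m <= 1)%N ->
  (2 * #|tball u| <= 2 ^ 2 ^ m)%N.
Proof.
rewrite /tball cardsE -sum1_card big_mkcond /=.
case: m u => [|[|//]] u _.
  by case: u; rewrite big_bool /= /in_mem /=.
have -> : (\sum_(v : btree 1) (if v \in [pred v | 32 * tdist u v < 2 ^ 1] then 1 else 0) =
  \sum_(a : bool) \sum_(b : bool) (if 32 * @tdist 1 u (a, b) < 2 then 1 else 0))%N.
  by rewrite pair_bigA.
by case: u => [[] []]; rewrite !big_bool.
Qed.

(** * The ultrametric of a nested family of codes *)

Local Open Scope classical_set_scope.

Section CodeMetric.
Context (d : measure_display) (T : measurableType d) (R : realType).
Variables (U : countType) (code : nat -> T -> U).
Hypothesis codeS : forall N x y, code N.+1 x = code N.+1 y -> code N x = code N y.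
Hypothesis code_inj : forall x y, (forall N, code N x = code N y) -> x = y.
Hypothesis code_measurable : forall N s, measurable [set x | code N x = s].

(* The supremum of the empty set is [0]. *)
Definition code_dist (x y : T) : R :=
  sup [set (2 ^+ N)^-1 | N in [set N | code N x <> code N y]].

Lemma code_le M N x y : (M <= N)%N -> code N x = code N y -> code M x = code M y.
Proof.
move=> /subnK <-; elim: (N - M)%N => // k IH; rewrite addSn => /codeS; exact: IH.
Qed.

Lemma invr_exp2_le (M N : nat) : (M <= N)%N -> (2 ^+ N)^-1 <= (2 ^+ M)^-1 :> R.
Proof. by move=> MN; rewrite lef_pV2 ?posrE ?exprn_gt0 // ler_weXn2l // ler1n. Qed.

Lemma code_dist_ubound x y :
  ubound [set ((2 ^+ N)^-1 : R) | N in [set N | code N x <> code N y]] 1.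
Proof. by move=> _ [N _ <-]; have := invr_exp2_le (leq0n N); rewrite expr0 invr1. Qed.

Lemma code_dist_ge N x y : code N x <> code N y -> (2 ^+ N)^-1 <= code_dist x y.
Proof.
move=> neq; apply: ub_le_sup; last by exists N.
by exists 1; apply: code_dist_ubound.
Qed.

Lemma code_dist_lub x y r : 0 <= r ->
  (forall N, code N x <> code N y -> (2 ^+ N)^-1 <= r) -> code_dist x y <= r.
Proof.
move=> r0 ub; rewrite /code_dist; set E := [set _ | _ in _].
have [->|/set0P E0] := eqVneq E set0; first by rewrite sup0.
by apply: ge_sup => // ? [N neq <-]; exact: ub.
Qed.

Lemma code_dist_ge0 x y : 0 <= code_dist x y.
Proof.
case: (pselect (exists N, code N x <> code N y)) => [[N neq]|none].
  by apply: le_trans (code_dist_ge neq); rewrite invr_ge0 exprn_ge0.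
rewrite /code_dist; set E := [set _ | _ in _].
suff -> : E = set0 by rewrite sup0.
by apply/seteqP; split=> // ? [N neq _]; apply: none; exists N.
Qed.

Lemma code_dist_le1 x y : code_dist x y <= 1.
Proof. by apply: code_dist_lub => // N neq; apply: (@code_dist_ubound x y); exists N. Qed.

Lemma code_dist_le N x y : code N x = code N y -> code_dist x y <= (2 ^+ N)^-1.
Proof.
move=> eq; apply: code_dist_lub => [|M neq]; first by rewrite invr_ge0 exprn_ge0.
apply: invr_exp2_le; rewrite leqNgt; apply/negP => /ltnW MN.
exact/neq/code_le/eq.
Qed.

Lemma invr_exp2_small (e : R) : 0 < e -> exists N, (2 ^+ N)^-1 < e.
Proof.
move=> e0; exists (Num.bound e^-1).
rewrite invf_plt ?posrE ?exprn_gt0 //.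
have e1 : 0 <= e^-1 by rewrite invr_ge0 ltW.
apply: lt_trans (archi_boundP e1) _.
by rewrite -natrX ltr_nat ltn_expl.
Qed.

(** Codes take countably many values, so equality of codes is a countable union of rectangles. *)
Lemma measurable_code_neq N : measurable [set z : T * T | code N z.1 <> code N z.2].
Proof.
rewrite (_ : mkset _ = ~` \bigcup_s ([set x | code N x = s] `*` [set x | code N x = s])).
  apply: measurableC; apply: countable_bigcupT_measurable => // s.
  exact: measurableX.
apply/seteqP; split=> [[x y] /= neq [s _ [/= xs ys]]|[x y] /= neq eq].
  by apply: neq; rewrite xs ys.
by apply: neq; exists (code N x).
Qed.

Lemma measurable_code_dist :
  measurable_fun setT (fun z : T * T => code_dist z.1 z.2).
Proof.
apply: (measurability _ (RGenOInfty.measurableE R)).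
move=> _ [_ [r ->] <-]; rewrite setTI.
have [r0|r0] := ltP r 0.
  rewrite (_ : _ @^-1` _ = setT) //; apply/seteqP; split=> // -[x y] _ /=.
  by rewrite in_itv /= andbT (lt_le_trans r0) // code_dist_ge0.
(* For [r >= 0] the default value [0] of an empty supremum does not exceed [r], so exceeding [r]
   means that some term does. *)
rewrite (_ : _ @^-1` _ =
  \bigcup_(N in [set N | r < (2 ^+ N)^-1]) [set z : T * T | code N z.1 <> code N z.2]).
  by apply: bigcup_measurable => N _; exact: measurable_code_neq.
apply/seteqP; split=> [[x y]|[x y] [N /= lt neq]] /=; rewrite in_itv /= andbT.
  move=> lt; have [|_ [N neq <-] ltN] := sup_gt _ lt; last by exists N.
  apply/set0P/eqP => E0; move: lt; rewrite /code_dist E0 sup0.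
  by rewrite ltNge r0.
by apply: (lt_le_trans lt); apply: code_dist_ge.
Qed.

Lemma code_dist_admissible (mu : probability T R) : admissible mu code_dist.
Proof.
split; first exact: measurable_code_dist.
split.
  apply: measurable_bounded_integrable => //.
  - rewrite -setXTT /= product_measure1E // -[ltLHS]/(mu setT * mu setT)%E.
    by rewrite probability_setT mule1 ltry.
  - exact: measurable_code_dist.
  - exists 1; split=> [|M M1 z _]; first exact: num_real.
    by rewrite /= ger0_norm ?code_dist_ge0 // (le_trans (code_dist_le1 _ _)) // ltW.
exists setT; split=> //; split; first by rewrite setCT measure0.
split=> [x y _ _|].
  split=> [z|->]; last first.
    by apply/eqP; rewrite eq_le code_dist_ge0 code_dist_lub.
  apply: code_inj => N; apply: contrapT => /code_dist_ge; rewrite z.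
  by rewrite leNgt invr_gt0 exprn_gt0.
split=> [x y _ _|].
  by rewrite /code_dist; congr sup; congr image; apply/seteqP; split=> N /= neq /esym.
split=> [x y z _ _ _|].
  apply: code_dist_lub => [|N neq]; first by rewrite addr_ge0 ?code_dist_ge0.
  have [xy|xy] := eqVneq (code N x) (code N y).
    rewrite -[leLHS]add0r lerD ?code_dist_ge0 // code_dist_ge //.
    by move=> yz; apply: neq; rewrite xy.
  by rewrite -[leLHS]addr0 lerD ?code_dist_ge0 // code_dist_ge //; exact/eqP.
(* One point for each level and each code value gives a countable dense set; values that are not
   attained get the default [point]. *)
pose rep (Ns : nat * U) : T := xget point [set x | code Ns.1 x = Ns.2].
exists (range rep); split=> //; split.
  exact: (sub_countable (card_image_le _ _) (countableP _)).
move=> x _ e /invr_exp2_small[N ltN]; exists (rep (N, code N x)); first by exists (N, code N x).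
apply: le_lt_trans ltN; apply: code_dist_le; rewrite /rep /=.
apply/esym; exact: (@xgetI _ point [set z | code N z = code N x] x).
Qed.

Lemma measurable_code_invariant N (B : set T) :
  (forall x y, code N x = code N y -> B x -> B y) -> measurable B.
Proof.
move=> inv; rewrite (_ : B = \bigcup_s [set x | code N x = s /\ exists2 y, B y & code N y = s]).
  apply: countable_bigcupT_measurable => // s.
  have [[y By eys]|none] := pselect (exists2 y, B y & code N y = s).
    rewrite (_ : mkset _ = [set x | code N x = s]); first exact: code_measurable.
    by apply/seteqP; split=> [x []//|x xs]; split=> //; exists y.
  by rewrite (_ : mkset _ = set0) // -subset0 => x [_ /none].
apply/seteqP; split=> [x Bx|x [s _ [<- [y By /inv]]]]; last exact.
by exists (code N x) => //; split=> //; exists x.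
Qed.

End CodeMetric.

(** * Entropy of the orbit filtration *)

Lemma limn_esup_le (R : realType) (u : nat -> \bar R) (c : \bar R) N :
  (forall n, (N <= n)%N -> (u n <= c)%E) -> (limn_esup u <= c)%E.
Proof.
move=> uc; apply: ge_ereal_inf; exists (ereal_sup [set u n | n in [set n | (N <= n)%N]]).
  by exists [set n | (N <= n)%N] => //; exists N.
by apply: ge_ereal_sup => _ [n Nn <-]; exact: uc.
Qed.

Lemma limn_einf_ge (R : realType) (u : nat -> \bar R) (c : \bar R) :
  (forall n, (c <= u n)%E) -> (c <= limn_einf u)%E.
Proof.
move=> cu; rewrite /limn_einf leeNr; apply: (@limn_esup_le _ _ _ 0) => n _.
by rewrite leeN2.
Qed.

(** * Orbits of an abstract action, to be applied to [diag] and to the path space *)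

Section ConfigurationAction.
Context (d : measure_display) (T : measurableType d) (R : realType).
Variables (W A : T -> nat -> bool) (act : nat -> T -> T).
Variable S : nat -> T -> T -> Prop.
Hypothesis act_W : forall g x k, W (act g x) k = W x (k (^) g).
Hypothesis act_A : forall g x i, A (act g x) i = xorb (A x i) (Nat.testbit g i).
Hypothesis WA_inj : forall x y, W x =1 W y -> A x =1 A y -> x = y.
Hypothesis measurable_W : forall k b, measurable [set x | W x k = b].
Hypothesis measurable_A : forall i b, measurable [set x | A x i = b].
Hypothesis SE : forall n x y, S n x y <-> exists g, (g < 2 ^ n)%N /\ y = act g x.

Lemma act_act g h x : act g (act h x) = act (h (^) g) x.
Proof.
apply: WA_inj => i; first by rewrite !act_W -lxorA (lxorC g).
by rewrite !act_A Nat.lxor_spec Bool.xorb_assoc.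
Qed.

Lemma act0 x : act 0 x = x.
Proof.
apply: WA_inj => i; first by rewrite act_W Nat.lxor_0_r.
by rewrite act_A Nat.bits_0 Bool.xorb_false_r.
Qed.

Lemma actK g : involutive (act g).
Proof. by move=> x; rewrite act_act Nat.lxor_nilpotent act0. Qed.

Lemma act_free x : injective (act^~ x).
Proof.
move=> g h /(congr1 A) /funeqP e; apply: Nat.bits_inj => i.
by have := e i; rewrite !act_A; case: (A x i) (Nat.testbit _ _) (Nat.testbit _ _) => [] [] [].
Qed.

Lemma S_act n g x : (g < 2 ^ n)%N -> S n x (act g x).
Proof. by move=> lt; apply/SE; exists g. Qed.

Lemma S_refl n x : S n x x.
Proof. by rewrite -[X in S n x X]act0; apply: S_act; rewrite expn_gt0. Qed.

Lemma S_sym n x y : S n x y -> S n y x.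
Proof. by move=> /SE[g [lt ->]]; rewrite -[X in S n _ X](actK g); exact: S_act. Qed.

Lemma S_trans n x y z : S n x y -> S n y z -> S n x z.
Proof.
move=> /SE[g [ltg ->]] /SE[h [lth ->]]; rewrite act_act; apply: S_act.
exact: lxor_lt.
Qed.

Lemma S_class n x y : S n x y -> S n y = S n x.
Proof.
by move=> xy; apply/seteqP; split=> z; apply: S_trans => //; exact: S_sym.
Qed.

Lemma S_leS n x y : S n x y -> S n.+1 x y.
Proof. by move=> /SE[g [/ltn_exp2S lt ->]]; exact: S_act. Qed.

Lemma fsum_S n x (F : T -> R) :
  \sum_(z \in S n x) F z = \sum_(g < 2 ^ n) F (act g x).
Proof.
rewrite (fsbig_ord _ _ (fun g => F (act g x))).
rewrite -(fsbig_image `I_(2 ^ n) (act^~ x)) /=; last by move=> g h _ _; exact: act_free.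
apply: eq_fsbigl; apply/seteqP; split=> z.
  by move=> /SE[g [lt ->]]; exists g.
by move=> [g lt <-]; exact: S_act.
Qed.

Definition event (x : T) (c : nat + nat) : bool :=
  match c with inl k => W x k | inr i => A x i end.

(** Level [0] already contains the value at [0], since [D_0] has one element; points differing there
    are at distance [1]. *)
Definition code (N : nat) (x : T) : seq bool :=
  map (event x) (map inl (iota 0 (2 ^ N)) ++ map inr (iota 0 N)).

Lemma codeP N x y : code N x = code N y <->
  (forall k, (k < 2 ^ N)%N -> W x k = W y k) /\ (forall i, (i < N)%N -> A x i = A y i).
Proof.
split=> [/eq_in_map e|[eW eA]].
  split=> [k lt|i lt].
    by have := e (inl k); apply; rewrite mem_cat map_f // mem_iota add0n.
  by have := e (inr i); apply; rewrite mem_cat (map_f inr) ?orbT // mem_iota add0n.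
apply/eq_in_map => c; rewrite mem_cat => /orP[] /mapP[k]; rewrite mem_iota /= add0n => lt -> /=.
  exact: eW.
exact: eA.
Qed.

Lemma codeS N x y : code N.+1 x = code N.+1 y -> code N x = code N y.
Proof.
move=> /codeP[eW eA]; apply/codeP; split=> [k lt|i lt].
  exact/eW/ltn_exp2S.
by apply: eA; exact: ltnW.
Qed.

Lemma code_inj x y : (forall N, code N x = code N y) -> x = y.
Proof.
move=> e; apply: WA_inj => k; have /codeP[eW eA] := e k.+1.
  by apply/eW/(ltn_trans _ (ltn_expl _ _)).
exact: eA.
Qed.

Lemma measurable_code N s : measurable [set x | code N x = s].
Proof.
rewrite /code; move: (_ ++ _) => cs; elim: cs s => [|c cs IH] [|b s] /=.
- by rewrite (_ : mkset _ = setT) //; apply/seteqP; split.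
- by rewrite (_ : mkset _ = set0) //; apply/seteqP; split.
- by rewrite (_ : mkset _ = set0) //; apply/seteqP; split.
rewrite (_ : mkset _ = [set x | event x c = b] `&` [set x | map (event x) cs = s]).
  by apply: measurableI => //; case: c => k /=; [exact: measurable_W|exact: measurable_A].
by apply/seteqP; split=> x /= [-> ->].
Qed.

(** * Kantorovich distances between orbits *)

Local Notation rho := (code_dist R code).

Lemma ord_split_exp2S n (F : nat -> R) :
  \sum_(g < 2 ^ n.+1) F g = \sum_(g < 2 ^ n) F g + \sum_(g < 2 ^ n) F (g (^) 2 ^ n)%N.
Proof.
rewrite -!(big_mkord xpredT F) (big_cat_nat _ (n := 2 ^ n)) //=; last first.
  by rewrite ltnW // exp2_ltS.
congr (_ + _); rewrite -{1}[(2 ^ n)%N]add0n big_addn expnS mul2n -addnn addnK big_mkord.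
by apply: eq_bigr => i _; rewrite addnC addn_lxor.
Qed.

(** Induction over the two halves of the class of [x]: [s] maps each of them onto a half, and the
    cost of [s] is the sum of the costs on the halves. *)
Lemma tdist_le_sum n x (s : T -> T) :
  (forall j z, (j <= n)%N -> S n x z -> s @` S j z = S j (s z)) ->
  set_inj (S n x) s ->
  (tdist (config_tree n (W x)) (config_tree n (W (s x))))%:R <=
    \sum_(g < 2 ^ n) rho (act g x) (s (act g x)).
Proof.
elim: n x => [|n IH] x sS inj_s.
  rewrite expn0 big_ord_recl big_ord0 addr0 act0 /=.
  have [_|neq] := eqVneq (W x 0) (W (s x) 0); first exact: code_dist_ge0.
  have := @code_dist_ge _ _ R _ code 0 x (s x); rewrite expr0 invr1; apply.
  by move=> /codeP[e _]; move/eqP: neq; apply; apply: e.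
pose x' := act (2 ^ n)%N x.
have xx' : S n.+1 x x' by apply: S_act; exact: exp2_ltS.
have le1 z : S n x z -> S n.+1 x z by exact: S_leS.
have le2 z : S n x' z -> S n.+1 x z by move/S_leS; exact: S_trans.
rewrite (ord_split_exp2S n (fun g => rho (act g x) (s (act g x)))).
have -> : \sum_(g < 2 ^ n) rho (act (g (^) 2 ^ n)%N x) (s (act (g (^) 2 ^ n)%N x)) =
          \sum_(g < 2 ^ n) rho (act g x') (s (act g x')).
  by apply: eq_bigr => g _; rewrite /x' act_act lxorC.
have h1 := IH x _ _; have h2 := IH x' _ _.
apply: le_trans (lerD (h1 _ _) (h2 _ _)); first last.
- by move=> a b /set_mem/le2 ha /set_mem/le2 hb; apply: inj_s; exact/mem_set.
- by move=> j z jn /le2; apply: sS; exact: leqW.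
- by move=> a b /set_mem/le1 ha /set_mem/le1 hb; apply: inj_s; exact/mem_set.
- by move=> j z jn /le1; apply: sS; exact: leqW.
have /SE[g [ltg eg]] : S n.+1 (s x) (s x').
  by rewrite -(sS n.+1 x (leqnn _) (S_refl _ _)); exists x'.
(* If [s x'] were in the half of [s x], injectivity would put [x'] in the half of [x], against
   freeness. *)
have [gn|[h lth hE]] := ltn_exp2SP ltg.
  exfalso.
  have : S n (s x) (s x') by rewrite eg; exact: S_act.
  rewrite -(sS n x (leqnSn n) (S_refl _ _)).
  move=> [z xz /inj_s]; rewrite !inE => /(_ (le1 _ xz) xx') zx'.
  move: xz; rewrite zx' => /SE[k [ltk /act_free ek]].
  by move: ltk; rewrite -ek ltnn.
(* The target tree is read from [s x], so the half of [s x] comes first and the first matching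
   applies; the remaining translation by [h] inside the other half is absorbed by [tdist_shift]. *)
rewrite -natrD ler_nat /= geq_min; apply/orP; left.
have -> : config_tree n (W x') = config_tree n (fun k => W x (k (^) 2 ^ n)%N).
  by apply/config_tree_eqP => k _; rewrite act_W.
have -> : config_tree n (W (s x')) = config_tree n (fun k => W (act (2 ^ n)%N (s x)) (k (^) h)).
  apply/config_tree_eqP => k _.
  by rewrite eg hE !act_W !lxorA.
rewrite (tdist_shift _ (W (act (2 ^ n)%N (s x))) lth).
suff -> : config_tree n (W (act (2 ^ n)%N (s x))) = config_tree n (fun k => W (s x) (k (^) 2 ^ n)%N) by [].
by apply/config_tree_eqP => k _; rewrite act_W.
Qed.

Lemma Kant_ge n x y :
  (((2 ^+ n)^-1 * (tdist (config_tree n (W x)) (config_tree n (W y)))%:R)%:E <= Kant S rho n x y)%E.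
Proof.
apply: le_ereal_inf_tmp => _ [s [bij_s sS] <-].
rewrite lee_fin ler_pM2l ?invr_gt0 ?exprn_gt0 // fsum_S.
have [maps inj_s onto] := bij_s.
have ysx : S n y (s x) by apply: maps; exact: S_refl.
have /SE[g [ltg eg]] := ysx.
have -> : tdist (config_tree n (W x)) (config_tree n (W y)) = tdist (config_tree n (W x)) (config_tree n (W (s x))).
  rewrite -(tdist_shift _ (W y) ltg); congr tdist.
  by apply/config_tree_eqP => k _; rewrite eg act_W.
apply: tdist_le_sum inj_s => j z.
(* [Kant] constrains the levels below [n] only; level [n] is the bijectivity of [s] between the two
   classes. *)
rewrite leq_eqVlt => /predU1P[->|jn] xz; last exact: sS.
rewrite (S_class xz) (S_class (maps _ xz)).
apply/seteqP; split=> [_ [t xt <-]|t /onto]; [exact: maps | exact].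
Qed.

(* The point of the [S n]-class of [x] with [A] vanishing below [n]. *)
Definition normal_form n x := act (prefix_nat (A x) n) x.

Lemma normal_form_act n g x : (g < 2 ^ n)%N -> normal_form n (act g x) = normal_form n x.
Proof.
move=> ltg; rewrite /normal_form (prefix_nat_lxor (a := A x) ltg) ?act_act => [|i].
  by rewrite lxorC lxorK.
exact: act_A.
Qed.

Lemma normal_form_S n x y : S n x y -> normal_form n y = normal_form n x.
Proof. by move=> /SE[g [ltg ->]]; exact: normal_form_act. Qed.

Lemma Kant_le n x y :
  config_tree n (W (normal_form n x)) = config_tree n (W (normal_form n y)) ->
  (Kant S rho n x y <= ((2 ^+ n)^-1)%:E)%E.
Proof.
move=> /config_tree_eqP eqW.
(* The equivariant bijection taking [normal_form n x] to [normal_form n y]. On the class of [x], the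
   points [z] and [s z] agree on [D_n] and in the first [n] terms of [A], hence have the same code
   at level [n]. *)
pose s z := act (prefix_nat (A z) n) (normal_form n y).
have s_act g z : (g < 2 ^ n)%N -> s (act g z) = act g (s z).
  by move=> ltg; rewrite /s (prefix_nat_lxor (a := A z) (b := A (act g z)) ltg) ?act_act.
have sS z : S n y (s z).
  rewrite /s /normal_form act_act; apply: S_act.
  by apply: lxor_lt; exact: prefix_nat_lt.
apply: ge_ereal_inf; exists ((2 ^+ n)^-1 * \sum_(z \in S n x) rho z (s z))%:E.
  exists s => //; split; last first.
    move=> j jn z _; have lt g : (g < 2 ^ j)%N -> (g < 2 ^ n)%N.
      by move=> /leq_trans; apply; rewrite leq_exp2l // ltnW.
    apply/seteqP; split=> [_ [_ /SE[g [ltg ->]] <-]|_ /SE[g [ltg ->]]].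
      by rewrite s_act ?lt //; exact: S_act.
    by exists (act g z); [exact: S_act | rewrite s_act ?lt].
  split=> [z _|a b|t yt]; first exact: sS.
    rewrite !inE => /SE[g [ltg ->]] /SE[h [lth ->]]; rewrite !s_act //.
    by move=> /act_free ->.
  have /SE[g [ltg ->]] : S n (s x) t by rewrite (S_class (sS x)).
  by exists (act g x); [exact: S_act | exact: s_act].
rewrite lee_fin -[leRHS]mulr1 ler_pM2l ?invr_gt0 ?exprn_gt0 // fsum_S.
apply: (@le_trans _ _ (\sum_(g < 2 ^ n) (2 ^+ n)^-1)); last first.
  by rewrite sumr_const card_ord -(mulr_natl _ (2 ^ n)) natrX mulfV // expf_neq0.
apply: ler_sum => g _; apply: code_dist_le; first exact: codeS.
set z := act g x.
have zE : z = act (prefix_nat (A z) n) (normal_form n x).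
  by rewrite -(normal_form_act x (ltn_ord g)) /normal_form actK.
apply/codeP; split=> [k ltk|i lti].
  rewrite {1}zE (act_W _ (normal_form n x)) (act_W _ (normal_form n y)); apply: eqW; apply: lxor_lt => //; exact: prefix_nat_lt.
rewrite (act_A _ (normal_form n y)) (act_A _ y) !testbit_prefix_nat lti /=.
by case: (A y i) (A z i) => [] [].
Qed.

(** * Masses of configurations and sizes of partitions *)

Variables (sigma : nat -> bool) (mu : probability T R).
Hypothesis muW : forall (K : seq nat) (f : nat -> bool),
  mu [set x | forall k, k \in K -> W x k = f k] =
  if `[< forall k k', k \in K -> k' \in K -> same_coset sigma k k' -> f k = f k' >]
  then ((2 ^+ size (undup (map (coset_key sigma) K)))^-1)%:E else 0%E.

Local Notation ones := (nones sigma).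

Lemma measurable_finite_W N (B : set T) :
  (forall x y, (forall k, (k < 2 ^ N)%N -> W x k = W y k) -> B x -> B y) -> measurable B.
Proof.
move=> inv; apply: (measurable_code_invariant measurable_code (N := N)) => x y /codeP[eW _].
exact: inv.
Qed.

(** A countable union of events, each prescribing different values at two points of one coset of
    [D^sigma]; the cylinder formula gives these mass [0]. *)
Lemma not_invariant_negligible :
  mu.-negligible [set x | ~ invariant_config sigma (W x)].
Proof.
pose B i k b := [set x | sigma i = false /\ (W x (k (^) 2 ^ i)%N = b /\ W x k = ~~ b)].
apply: (@negligibleS _ _ _ _ (\bigcup_i \bigcup_k (B i k true `|` B i k false))).
  move=> x; apply: contra_notP => none i k si.
  apply/eqP; apply: contra_notT none => neq; exists i => //; exists k => //.
  move: neq; case E1: (W x (k (^) 2 ^ i)%N); case E2: (W x k) => //= _; [left|right];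
    by rewrite /B /= E1 E2.
apply: negligible_bigcup => i; apply: negligible_bigcup => k.
have [si|si] := boolP (sigma i).
  apply: (@negligibleS _ _ _ _ set0); last exact: negligible_set0.
  by move=> x [] [/=]; rewrite si.
have neqk : (k (^) 2 ^ i)%N != k.
  apply/eqP => /(congr1 (fun m => Nat.testbit m i)); rewrite Nat.lxor_spec testbit_exp2 eqxx.
  by case: Nat.testbit.
suff negB b : mu.-negligible (B i k b) by apply: negligibleU.
pose f j := if j == k then ~~ b else b.
exists [set x | forall j, j \in [:: k; (k (^) 2 ^ i)%N] -> W x j = f j]; split.
- apply: (@measurable_finite_W (k + (k (^) 2 ^ i))%N) => x y e Bx j jK.
  rewrite -(Bx j jK); apply/esym/e.
  move: jK; rewrite !inE => /orP[] /eqP -> ; apply: leq_ltn_trans (ltn_expl _ _) => //.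
    exact: leq_addr.
  exact: leq_addl.
- rewrite muW; case: asboolP => // /(_ k (k (^) 2 ^ i)%N).
  rewrite !inE !eqxx orbT => /(_ isT isT) H.
  exfalso; move: H; rewrite /f eqxx (negbTE neqk) => {}H.
  by have := H (same_coset_exp2 (negbTE si)); clear; case: b.
- move=> x [_ [Wb Wk]] j; rewrite !inE /f => /orP[] /eqP ->; first by rewrite eqxx.
  by rewrite (negbTE neqk).
Qed.

Lemma measurable_config_tree n (v : btree n) : measurable [set x | config_tree n (W x) = v].
Proof.
apply: (@measurable_finite_W n) => x y e <-; apply/config_tree_eqP => k ltk.
by rewrite e.
Qed.

(** The tree fixes the values on the transversal, whose [2 ^ ones n] points lie in distinct cosets
    and so carry independent uniform values. *)
Lemma mu_config_tree_le n (v : btree n) :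
  (mu [set x | config_tree n (W x) = v] <= ((2 ^+ (2 ^ ones n))^-1)%:E)%E.
Proof.
have pos : (0 <= ((2 ^+ (2 ^ ones n))^-1)%:E :> \bar R)%E by rewrite lee_fin invr_ge0 exprn_ge0.
have [[x1 ex1]|none] := pselect (exists x, config_tree n (W x) = v); last first.
  rewrite (_ : mkset _ = set0) ?measure0 //.
  by apply/seteqP; split=> // x ex; apply: none; exists x.
pose K := transversal_nat sigma n.
apply: (@le_trans _ _ (mu [set x | forall k, k \in K -> W x k = W x1 k])).
  apply: le_measure; rewrite ?inE; first exact: measurable_config_tree.
    apply: (@measurable_finite_W n) => x y e Bx k kK; rewrite -Bx //; apply/esym/e.
    by have [] := transversal_natP kK.
  move=> x /=; rewrite -ex1 => /config_tree_eqP e k kK; apply: e.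
  by have [] := transversal_natP kK.
rewrite muW; case: ifP => // _.
by rewrite undup_id ?coset_key_transversal_uniq // size_map size_transversal_nat.
Qed.

Lemma measure_bigsetU_le (I : Type) (r : seq I) (F : I -> set T) :
  (forall i, measurable (F i)) ->
  (mu (\big[setU/set0]_(i <- r) F i) <= \sum_(i <- r) mu (F i))%E.
Proof.
move=> mF; elim: r => [|i r IH]; first by rewrite !big_nil measure0.
rewrite !big_cons; apply: le_trans (leeD2l _ IH).
by apply: measureU2 => //; apply: bigsetU_measurable.
Qed.

(** Almost every point of [Y] has an invariant configuration, whose reduced tree lies in the ball
    around that of a fixed invariant point. Without such a point [Y] is null and any [u] serves. *)
Lemma mu_small_diam_le n (Y : set T) : measurable Y ->
  (forall x y, Y x -> Y y -> (Kant S rho n x y < (1 / 32)%:E)%E) ->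
  exists u : btree (ones n), (mu Y <= (#|tball u|%:R * (2 ^+ (2 ^ ones n))^-1)%:E)%E.
Proof.
move=> mY diamY.
have [N [mN muN subN]] := not_invariant_negligible.
have [[x0 [Yx0 inv0]]|none] := pselect (exists x, Y x /\ invariant_config sigma (W x)); last first.
  exists (config_tree _ (fun=> false)).
  apply: (@le_trans _ _ (mu N)).
    apply: le_measure; rewrite ?inE // => x Yx; apply: subN => /= inv.
    by apply: none; exists x.
  by rewrite muN lee_fin mulr_ge0 // invr_ge0 exprn_ge0.
have [u0 eu0] := invariant_tree_expand n inv0; exists u0.
pose F u := [set x | config_tree n (W x) = @tree_expand sigma n u].
have mF u : measurable (F u) by exact: measurable_config_tree.
apply: (@le_trans _ _ (mu (N `|` \big[setU/set0]_(u <- enum (tball u0)) F u))).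
  apply: le_measure; rewrite ?inE //; first by apply: measurableU => //; apply: bigsetU_measurable.
  move=> x Yx; have [inv|] := pselect (invariant_config sigma (W x)); last by left; apply: subN.
  right; have [u eu] := invariant_tree_expand n inv.
  rewrite -bigcup_seq; exists u => //=; rewrite mem_enum inE.
  have := le_lt_trans (Kant_ge n x0 x) (diamY x0 x Yx0 Yx).
  rewrite eu0 eu lte_fin mulrC ltr_pdivrMr ?exprn_gt0 // => lt.
  (* Multiplication by [2 ^ n] turns the distance of the reduced trees into that of their
     expansions. *)
  rewrite -(ltn_pmul2l (expn_gt0 2 n)) mulnCA -tdist_tree_expand mulnCA.
  rewrite [(2 ^ n * 2 ^ _)%N]mulnC ltn_pmul2l ?expn_gt0 // -(ltr_nat R).
  by rewrite natrM natrX; lra.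
apply: le_trans (measureU2 _ _ _) _ => //; first by apply: bigsetU_measurable.
rewrite [X in (X + _)%E](_ : _ = 0%E) // add0e.
apply: le_trans (measure_bigsetU_le _ mF) _.
apply: (@le_trans _ _ (\sum_(u <- enum (tball u0)) ((2 ^+ (2 ^ ones n))^-1)%:E)%E).
  by apply: lee_sum => u _; exact: mu_config_tree_le.
by rewrite sumEFin lee_fin big_const_seq count_predT iter_addr_0 -cardE mulr_natl.
Qed.

(** The exceptional set has mass below [1 / 32], so the [k] others, each of mass at most [C / 2]
    divided by [2 ^ 2 ^ ones n], cover at least [31 / 32]. *)
Lemma eps_partition_card_ge n k (eps C : R) : eps < 1 / 32 ->
  eps_partition mu S rho eps n k ->
  (forall u : btree (ones n), 2 * #|tball u|%:R <= C) ->
  31 / 16 * 2 ^+ (2 ^ ones n) <= k%:R * C.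
Proof.
move=> eps32 [Y [mY [_ [covY [muY0 diamY]]]]] ballC.
set h := (2 ^+ (2 ^ ones n) : R); have h0 : 0 < h by rewrite exprn_gt0.
have muYj j : (1 <= j <= k)%N -> (mu (Y j) <= (C / 2 * h^-1)%:E)%E.
  move=> jk; have [_ /mY[mYj _]] := andP jk.
  have [x y Yx Yy|u ub] := @mu_small_diam_le n (Y j) mYj.
    apply: le_lt_trans (lt_trans (diamY j jk) _); last by rewrite lte_fin.
    by apply: ereal_sup_ubound; exists x, y.
  apply: (le_trans ub); rewrite lee_fin ler_pM2r ?invr_gt0 //.
  by have := ballC u; lra.
have : (1 <= (1 / 32 + k%:R * (C / 2 * h^-1))%:E :> \bar R)%E.
  rewrite -(probability_setT mu).
  apply: (@le_trans _ _ (\sum_(j < k.+1) mu (Y j))%E).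
    apply: content_subadditive => //; first by move=> j /= jk; apply: (mY j _).1.
    by rewrite -covY -bigcup_mkord => x [j jk Yj]; exists j.
  rewrite big_ord_recl EFinD; apply: leeD.
    by apply: ltW; apply: (lt_trans muY0); rewrite lte_fin.
  apply: (@le_trans _ _ (\sum_(j < k) (C / 2 * h^-1)%:E)%E).
    by apply: lee_sum => j _; apply: muYj; rewrite /= ltn_ord.
  by rewrite sumEFin lee_fin sumr_const card_ord mulr_natl.
rewrite lee_fin => le1.
have hV : h * h^-1 = 1 by rewrite mulfV // gt_eqF.
have : h * 1 <= h * (1 / 32 + k%:R * (C / 2 * h^-1)) by rewrite ler_pM2l.
have -> : h * (1 / 32 + k%:R * (C / 2 * h^-1)) = h / 32 + k%:R * C / 2 * (h * h^-1) by ring.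
by rewrite hV; lra.
Qed.

Lemma ln_eps_partition_card_ge n k (eps : R) : eps < 1 / 32 ->
  eps_partition mu S rho eps n k ->
  (0 < k)%N /\ ln (16 / 13) / 4 * 2 ^+ ones n <= ln k%:R :> R.
Proof.
move=> eps32 part.
have ln1613 : 0 <= ln (16 / 13 : R) by apply: ln_ge0; lra.
have := eps_partition_card_ge eps32 part.
(* With at most two leaves [C] can be [2 ^ 2 ^ ones n] and cancels; then [k >= 31 / 16] forces
   [k >= 2]. *)
have [m1|] := leqP (ones n) 1.
  move=> /(_ (2 ^+ (2 ^ ones n))) H.
  have {}H : 31 / 16 * 2 ^+ (2 ^ ones n) <= k%:R * 2 ^+ (2 ^ ones n) :> R.
    apply: H => u; rewrite -natrX -natrM ler_nat.
    exact: card_tball_small.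
  move: H; rewrite ler_pM2r ?exprn_gt0 // => H.
  have k1 : (1 < k)%N by rewrite -(ltr_nat R); lra.
  split; first exact: ltnW.
  have lnk : ln (16 / 13) <= ln (k%:R : R).
    by rewrite ler_ln ?posrE ?ltr0n ?(ltnW k1) //; lra.
  apply: le_trans lnk; rewrite -[leRHS]mulr1 -mulrA ler_wpM2l //.
  have : 2 ^+ ones n <= 2 :> R by rewrite -[leRHS]expr1 ler_weXn2l // ler1n.
  lra.
move=> m2; move: m2 (card_tball R) => {part}.
case: (ones n) => [|[|p]] // _ ball /(_ (13 ^+ (2 ^ p)) (@ball p)).
(* Here [ones n] is [p + 2], so there are [16 ^ q] reduced trees, and [q], a quarter of
   [2 ^ ones n], accounts for the divisor 4. *)
set q := (2 ^ p)%N => H.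
have e16 : 2 ^+ (2 ^ p.+2) = 16 ^+ q :> R.
  by rewrite !expnS mulnA exprM -/q; congr (_ ^+ _); rewrite -natrX.
rewrite e16 in H.
have {}H : (16 / 13) ^+ q <= k%:R :> R.
  rewrite expr_div_n ler_pdivrMr ?exprn_gt0 //; apply: le_trans H.
  by have : 0 <= 16 ^+ q :> R by [rewrite exprn_ge0]; lra.
have q0 : 0 < (16 / 13) ^+ q :> R by rewrite exprn_gt0 //; lra.
have k0 : 0 < k%:R :> R by exact: lt_le_trans H.
split; first by rewrite -(ltr0n R).
have : ln ((16 / 13) ^+ q) <= ln (k%:R : R) by rewrite ler_ln ?posrE.
rewrite lnXn; last lra.
rewrite -[X in X <= _ -> _]mulr_natl /q natrX !exprS; lra.
Qed.

Lemma eps_partition_btree n (eps : R) : (2 ^+ n)^-1 < eps ->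
  eps_partition mu S rho eps n (2 ^ 2 ^ ones n).
Proof.
move=> small.
pose V x := config_tree n (W (normal_form n x)).
(* The parts with positive index are numbered by reduced trees; index [0] is kept for the null set
   where the tree of the normal form is not an expansion. *)
pose g x : nat := if [pick u | V x == @tree_expand sigma n u] is Some u
                  then (enum_rank u).+1 else 0.
have gV x y : V x = V y -> g x = g y by rewrite /g => ->.
have eps0 : 0 < eps by apply: lt_trans small; rewrite invr_gt0 exprn_gt0.
have mg j : measurable [set x | g x = j].
  apply: (measurable_code_invariant measurable_code (N := n)) => x y /codeP[eW eA] <-.
  apply: gV; apply/config_tree_eqP => k ltk; rewrite !act_W.
  have -> : prefix_nat (A y) n = prefix_nat (A x) n.
    apply: Nat.bits_inj => i; rewrite !testbit_prefix_nat.
    by case: ltnP => //= /eA ->.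
  by apply/esym/eW/lxor_lt => //; exact: prefix_nat_lt.
exists (fun j => [set x | g x = j]); split=> [j jk|].
  split=> // x y xy <-; apply: gV.
  by rewrite /V (normal_form_S xy).
split=> [i j _ _ ij|].
  by apply/seteqP; split=> // x [/= xi xj]; apply: ij; rewrite -xi -xj.
split.
  apply/seteqP; split=> // x _; exists (g x) => //=; rewrite /g.
  by case: pickP => // u _; rewrite -card_btree ltn_ord.
split.
  rewrite measure_negligible ?lte_fin //; apply: negligibleS not_invariant_negligible.
  move=> x /=; rewrite /g; case: pickP => // none _ inv.
  have [u eu] := invariant_tree_expand n (invariant_configS (prefix_nat (A x) n) inv).
  have /eqP := none u; apply; rewrite -eu; apply/config_tree_eqP => k _.
  by rewrite act_W.
move=> j /andP[j1 _]; apply: le_lt_trans (_ : (((2 ^+ n)^-1)%:E < _)%E); last by rewrite lte_fin.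
apply: ge_ereal_sup => _ [x [y [/= gx [gy ->]]]]; apply: Kant_le.
move: gx gy; rewrite -/(V x) -/(V y) /g; case: pickP => [u /eqP ->|_ jE]; last by rewrite -jE in j1.
case: pickP => [v /eqP ->|_ _ jE]; last by rewrite -jE in j1.
by move=> <- [/ord_inj/enum_rank_inj ->].
Qed.

(** * Entropy bounds and the scaling sequence *)

Lemma entropy_ge n (eps : R) : eps < 1 / 32 ->
  ((ln (16 / 13) / 4 / ln 2 * 2 ^+ ones n)%:E <= entropy mu S rho eps n)%E.
Proof.
move=> eps32; rewrite /entropy.
have ln2 : 0 < ln 2 :> R by apply: ln_gt0; lra.
set E := [set _ | _ in _].
have : ((expR (ln (16 / 13) / 4 * 2 ^+ ones n))%:E <= ereal_inf E)%E.
  apply: le_ereal_inf_tmp => _ [k part <-]; rewrite lee_fin.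
  have [k0 le] := ln_eps_partition_card_ge eps32 part.
  by rewrite -[leRHS](@lnK _) ?posrE ?ltr0n // ler_expR.
case: (ereal_inf E) => [r| |] //; rewrite ?leey // lee_fin => le.
rewrite lee_fin mulrAC ler_pM2r ?invr_gt0 //.
rewrite -[leLHS]expRK ler_ln ?posrE ?expR_gt0 //.
exact: lt_le_trans (expR_gt0 _) le.
Qed.

Lemma entropy_le n (eps : R) : (2 ^+ n)^-1 < eps -> eps < 1 / 32 ->
  (entropy mu S rho eps n <= (2 ^+ ones n)%:E)%E.
Proof.
move=> small eps32; rewrite /entropy.
have ln2 : 0 < ln 2 :> R by apply: ln_gt0; lra.
set E := [set _ | _ in _].
have ub : (ereal_inf E <= (2 ^+ (2 ^ ones n))%:E)%E.
  apply: ge_ereal_inf; exists ((2 ^ 2 ^ ones n)%N%:R)%:E; last by rewrite natrX.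
  by exists (2 ^ 2 ^ ones n)%N => //; exact: eps_partition_btree.
(* Excludes the infimum [-oo], at which [entropy] would be [+oo], and makes [r] positive for the
   monotonicity of [ln]. *)
have lb : (1%:E <= ereal_inf E)%E.
  apply: le_ereal_inf_tmp => _ [k /(ln_eps_partition_card_ge eps32)[k0 _] <-].
  by rewrite lee_fin ler1n.
case: (ereal_inf E) ub lb => [r| |] //; rewrite !lee_fin => ub lb.
rewrite ler_pdivrMr //.
have : ln r <= ln (2 ^+ (2 ^ ones n)) by rewrite ler_ln ?posrE ?exprn_gt0 //; lra.
by rewrite lnXn // -[X in _ <= X -> _]mulr_natl natrX.
Qed.

Theorem scaling_sequence_of_action :
  scaling_sequence mu S (fun n => 2%:R ^+ (\sum_(i < n) sigma i)%N).
Proof.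
exists rho; split.
  exact: (code_dist_admissible codeS code_inj measurable_code).
(* The radius of [tball]. Below it the lower bound holds for every [n], the upper one as soon as
   [2 ^ -n < eps]. *)
exists (1 / 32); split=> [|eps /andP[eps0 eps32]]; first lra.
have ln2 : 0 < ln 2 :> R by apply: ln_gt0; lra.
have lnc : 0 < ln (16 / 13) :> R by apply: ln_gt0; lra.
have pos n : 0 < 2%:R ^+ (\sum_(i < n) sigma i)%N :> R by rewrite exprn_gt0.
split.
  apply: (@lt_le_trans _ _ (ln (16 / 13) / 4 / ln 2)%:E).
    by rewrite lte_fin !mulr_gt0 ?invr_gt0 //.
  apply: limn_einf_ge => n; rewrite lee_pdivlMr //.
  by rewrite nonesE -EFinM; exact: entropy_ge.
have [N ltN] := invr_exp2_small eps0.
apply: (@le_lt_trans _ _ 1%E); last exact: ltry.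
apply: (@limn_esup_le _ _ _ N) => n Nn; rewrite lee_pdivrMr // mul1e nonesE.
apply: entropy_le => //; apply: le_lt_trans ltN; exact: invr_exp2_le.
Qed.

End ConfigurationAction.

(** * The path space *)

(** Inverse of [Phi]: the floor-[n] vertex labelled by the restriction of [w] to [D_n]. *)
Fixpoint op_vertex (n : nat) (w : nat -> bool) : OP n :=
  match n with
  | 0 => w 0%N
  | m.+1 => (op_vertex m w, op_vertex m (fun k => w (k (^) 2 ^ m)%N))
  end.

Lemma Phi_lower n (v : OP n.+1) h : (h < 2 ^ n)%N -> Phi v h = Phi v.1 h.
Proof. by move=> lt /=; rewrite lt. Qed.

Lemma Phi_upper n (v : OP n.+1) h : (h < 2 ^ n)%N -> Phi v (h (^) 2 ^ n)%N = Phi v.2 h.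
Proof. by move=> lt /=; rewrite -addn_lxor // ltnNge leq_addr /= addn_lxor // lxorC lxorK. Qed.

Lemma Phi_op_vertex n w h : (h < 2 ^ n)%N -> Phi (op_vertex n w) h = w h.
Proof.
elim: n w h => [|n IH] w h; first by case: h.
move=> /ltn_exp2SP[lt|[h' lt ->]]; first by rewrite Phi_lower // IH.
by rewrite Phi_upper // IH.
Qed.

Lemma Phi_inj n (u v : OP n) : (forall h, (h < 2 ^ n)%N -> Phi u h = Phi v h) -> u = v.
Proof.
elim: n u v => [|n IH] u v e; first exact: (e 0%N).
rewrite (surjective_pairing u) (surjective_pairing v); congr (_, _); apply: IH => h lt.
  by rewrite -!Phi_lower //; exact/e/ltn_exp2S.
rewrite -!Phi_upper //; apply: e.
by apply: lxor_lt; [exact: ltn_exp2S | exact: exp2_ltS].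
Qed.

Lemma op_vertexK n (v : OP n) : op_vertex n (nth false (mkseq (Phi v) (2 ^ n))) = v.
Proof. by apply: Phi_inj => h lt; rewrite Phi_op_vertex // nth_mkseq. Qed.

Lemma tshiftE x n : tshift x n = prefix_nat (te x) n.
Proof.
rewrite /tshift; elim: n => [|n IH]; first by rewrite big_ord0.
rewrite big_ord_recr /= IH; case: (te x n); rewrite ?mul0n ?addn0 ?Nat.lxor_0_r // mul1n.
by rewrite addnC addn_lxor // prefix_nat_lt.
Qed.

(** Makes [F] independent of the floor used to compute it: the edge index selects a component of
    [tv x n.+1], and the extra shift by [g_n] moves [h] into the matching half. *)
Lemma Phi_tvS (x : TOP) n h : (h < 2 ^ n)%N ->
  Phi (tv x n.+1) (h (^) prefix_nat (te x) n.+1) = Phi (tv x n) (h (^) prefix_nat (te x) n).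
Proof.
move=> lt; have lt' : (h (^) prefix_nat (te x) n < 2 ^ n)%N.
  by apply: lxor_lt => //; exact: prefix_nat_lt.
rewrite [tv x n]tpath [prefix_nat _ n.+1]/= lxorA; case: (te x n); last by rewrite Nat.lxor_0_r Phi_lower.
by rewrite Phi_upper.
Qed.

Lemma Phi_tv_le (x : TOP) n m h : (n <= m)%N -> (h < 2 ^ n)%N ->
  Phi (tv x m) (h (^) prefix_nat (te x) m) = Phi (tv x n) (h (^) prefix_nat (te x) n).
Proof.
move=> /subnK <- lt; elim: (m - n)%N => // k IH; rewrite addSn Phi_tvS //.
by apply: leq_trans lt _; rewrite leq_exp2l // leq_addl.
Qed.

Lemma Psi1E (x : Tm) n h : (h < 2 ^ n)%N ->
  (Psi x).1 h = Phi (tv x n) (h (^) prefix_nat (te x) n).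
Proof.
move=> lt; rewrite /= tshiftE; have [hn|/ltnW nh] := leqP h n.
  by rewrite -(Phi_tv_le x hn) // ltn_expl.
by rewrite (Phi_tv_le x nh).
Qed.

Lemma Phi_tvE (x : Tm) n h : (h < 2 ^ n)%N ->
  Phi (tv x n) h = (Psi x).1 (h (^) prefix_nat (te x) n).
Proof.
by move=> lt; rewrite (@Psi1E _ n) ?lxorK //; apply: lxor_lt => //; exact: prefix_nat_lt.
Qed.

Lemma TOP_eq (x y : TOP) : (forall n, tv x n = tv y n) -> te x =1 te y -> x = y.
Proof.
case: x y => [v e p] [v' e' p'] /= vv' /funext ee'; subst e'.
have vE : v = v' by apply: functional_extensionality_dep.
by subst v'; congr mkTOP; exact: Prop_irrelevance.
Qed.

Lemma Psi_inj : injective Psi.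
Proof.
move=> x y e; have ete : te x = te y by exact: (congr1 snd e).
apply: TOP_eq => [n|i]; last by rewrite ete.
by apply: Phi_inj => h lt; rewrite !Phi_tvE // e ete.
Qed.

(** * The inverse of [Psi] and the tail filtration *)

Lemma op_vertex_path (w a : nat -> bool) n :
  op_vertex n (fun h => w (h (^) prefix_nat a n)) =
  if a n then (op_vertex n.+1 (fun h => w (h (^) prefix_nat a n.+1))).2
         else (op_vertex n.+1 (fun h => w (h (^) prefix_nat a n.+1))).1.
Proof.
have -> (b : bool) (u v : OP n) : (if b then v else u) = (if b then (u, v).2 else (u, v).1) by [].
rewrite /=; case: (a n) => /=; apply: Phi_inj => h lt; rewrite !Phi_op_vertex //.
  by congr w; rewrite lxorA (lxorAC h) lxorK.
by rewrite Nat.lxor_0_r.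
Qed.

(** Inverse of [Psi]: the shift by the prefix is an involution, so the same shift recovers the
    vertices. *)
Definition path_of (z : Xm) : Tm :=
  @mkTOP (fun n => op_vertex n (fun h => z.1 (h (^) prefix_nat z.2 n))) z.2
    (op_vertex_path z.1 z.2).

Lemma path_ofK : cancel path_of Psi.
Proof.
move=> [w a]; rewrite /Psi; congr (_, _); apply/funext => g.
rewrite tshiftE /= Phi_op_vertex ?lxorK //.
by apply: lxor_lt; [exact: ltn_expl | exact: prefix_nat_lt].
Qed.

Lemma diagE g (z : Xm) : diag g z = (fun k => z.1 (k (^) g), fun i => xorb (z.2 i) (Nat.testbit g i)).
Proof. by []. Qed.

(** For paths agreeing from floor [n] on, [g] has its bits where the first [n] edge indices differ.
    Conversely, from floor [n] on the change of the prefix cancels the translation by [g], so the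
    vertices stay the same. *)
Lemma xi_diag n (x y : Tm) :
  xi n x y <-> exists g, (g < 2 ^ n)%N /\ y = path_of (diag g (Psi x)).
Proof.
split=> [[eqv eqe]|[g [ltg yE]]].
  pose g := (prefix_nat (te x) n (^) prefix_nat (te y) n).
  have ltg : (g < 2 ^ n)%N by apply: lxor_lt; exact: prefix_nat_lt.
  have eyi i : te y i = xorb (te x i) (Nat.testbit g i).
    rewrite Nat.lxor_spec !testbit_prefix_nat; case: ltnP => [_|/eqe ->] /=.
      by case: (te x i) (te y i) => [] [].
    by case: (te y i).
  exists g; split=> //; apply: Psi_inj; rewrite path_ofK diagE.
  rewrite [LHS]surjective_pairing; congr (_, _); last exact/funext/eyi.
  (* A floor at which the paths agree and whose [D_m] contains [k]. *)
  apply/funext => k; pose m := (n + k.+1)%N.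
  have ltm : (g < 2 ^ m)%N by apply: (leq_trans ltg); rewrite leq_exp2l // leq_addr.
  have ltk : (k < 2 ^ m)%N.
    by apply: (ltn_trans (ltn_expl k (isT : 1 < 2)%N)); rewrite ltn_exp2l // /m addnS ltnS leq_addl.
  rewrite (@Psi1E _ m) // (@Psi1E _ m); last exact: lxor_lt.
  rewrite eqv ?leq_addr // (prefix_nat_lxor ltm eyi).
  by rewrite -lxorA (lxorC g) lxorA.
have PsiyE : Psi y = diag g (Psi x) by rewrite yE path_ofK.
have eyi i : te y i = xorb (te x i) (Nat.testbit g i).
  exact: (congr1 (fun z => z.2 i) PsiyE).
split=> m nm; last by rewrite eyi (testbit_small ltg nm) Bool.xorb_false_r.
have ltm : (g < 2 ^ m)%N by apply: (leq_trans ltg); rewrite leq_exp2l.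
apply: Phi_inj => h lt; rewrite !Phi_tvE // PsiyE /= (prefix_nat_lxor ltm eyi).
by rewrite lxorA lxorK.
Qed.

Lemma measurable_te i b : measurable [set x : Tm | te x i = b].
Proof. by apply: sub_sigma_algebra; right; exists i, b. Qed.

Lemma measurable_tv n (B : set (OP n)) : measurable [set x : Tm | B (tv x n)].
Proof.
rewrite (_ : mkset _ = \bigcup_(s in [set: seq bool])
  [set x : Tm | tv x n = op_vertex n (nth false s) /\ B (op_vertex n (nth false s))]).
  apply: countable_bigcupT_measurable => // s.
  have [Bs|nB] := pselect (B (op_vertex n (nth false s))).
    rewrite (_ : mkset _ = [set x : Tm | tv x n = op_vertex n (nth false s)]).
      by apply: sub_sigma_algebra; left; exists n, (op_vertex n (nth false s)).
    by apply/seteqP; split=> x /= => [[]|].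
  by rewrite (_ : mkset _ = set0) //; apply/seteqP; split=> // x [].
apply/seteqP; split=> x /=; last by move=> [s _ [-> ?]].
by move=> Bx; exists (mkseq (Phi (tv x n)) (2 ^ n)) => //=; rewrite op_vertexK.
Qed.

Lemma measurable_prefix_te n c : measurable [set x : Tm | prefix_nat (te x) n = c].
Proof.
have [ltc|le] := ltnP c (2 ^ n); last first.
  rewrite (_ : mkset _ = set0) //; apply/seteqP; split=> // x /= e.
  by move: le; rewrite -e leqNgt prefix_nat_lt.
rewrite (_ : mkset _ = \bigcap_(i in `I_n) [set x : Tm | te x i = Nat.testbit c i]).
  by apply: bigcap_measurableType => i _; exact: measurable_te.
apply/seteqP; split=> x /= => [<- i /= lt|e].
  by rewrite testbit_prefix_nat lt.
apply: Nat.bits_inj => i; rewrite testbit_prefix_nat.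
by case: ltnP => /= [/e//|le]; rewrite (testbit_small ltc).
Qed.

(** Once the edge prefix [c] is fixed, coordinate [k] is a function of the vertex on floor [k]. *)
Lemma measurable_Psi1 k b : measurable [set x : Tm | (Psi x).1 k = b].
Proof.
rewrite (_ : mkset _ = \bigcup_c ([set x : Tm | prefix_nat (te x) k = c] `&`
                                  [set x : Tm | Phi (tv x k) (k (^) c) = b])).
  apply: bigcup_measurable => c _; apply: measurableI.
    exact: measurable_prefix_te.
  exact: (@measurable_tv k [set v | Phi v (k (^) c) = b]).
apply/seteqP; split=> x /=; rewrite tshiftE; first by exists (prefix_nat (te x) k).
by move=> [c _ [/= <-]].
Qed.

Theorem theorem9 (R : realType) (sigma : nat -> bool)
    (P : probability Xm R) (Q : probability Tm R) :
  omega_sigma sigma P ->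
  (forall B : set Tm, measurable B -> Q B = P (Psi @` B)) ->
  scaling_sequence P zeta (fun n => 2%:R ^+ (\sum_(i < n) sigma i)%N) /\
  scaling_sequence Q xi (fun n => 2%:R ^+ (\sum_(i < n) sigma i)%N).
Proof.
move=> omegaP QE.
have PW (K : seq nat) f : P [set z : Xm | forall k, k \in K -> z.1 k = f k] =
  if `[< forall k k', k \in K -> k' \in K -> same_coset sigma k k' -> f k = f k' >]
  then ((2 ^+ size (undup (map (coset_key sigma) K)))^-1)%:E else 0%E.
  rewrite -[size _]addn0 -(omegaP K [::] f xpredT); congr (P _).
  by apply/seteqP; split=> z /= => [|[]].
split.
  apply: (@scaling_sequence_of_action _ Xm R fst snd diag zeta) => //.
  - by move=> [w a] [w' a'] /= /funext -> /funext ->.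
  - by move=> k b; apply: sub_sigma_algebra; left; exists k, b.
  - by move=> k b; apply: sub_sigma_algebra; right; exists k, b.
(* The action on paths is [diag] conjugated by [Psi]; by [xi_diag] its orbits are the classes of
   [xi]. *)
apply: (@scaling_sequence_of_action _ Tm R (fun x => (Psi x).1) (fun x => (Psi x).2)
          (fun g x => path_of (diag g (Psi x))) xi).
- by move=> g x k; rewrite path_ofK.
- by move=> g x i; rewrite path_ofK.
- move=> x y /funext e1 /funext e2; apply: Psi_inj.
  by rewrite (surjective_pairing (Psi x)) (surjective_pairing (Psi y)) e1 e2.
- exact: measurable_Psi1.
- exact: measurable_te.
- exact: xi_diag.
move=> K f; rewrite -PW QE.
  congr (P _); apply/seteqP; split=> [_ [x Kx <-]//|z Kz].
  by exists (path_of z) => [k /Kz kf|]; rewrite path_ofK.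
rewrite (_ : mkset _ = \bigcap_(k in [set k | k \in K]) [set x : Tm | (Psi x).1 k = f k]) //.
by apply: bigcap_measurableType => k _; exact: measurable_Psi1.
Qed.
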